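(* For every integer $r\geq 2$, the homomorphism threshold of the cycle $C_{2r+1}$ satisfies $\delta_{\hom}(C_{2r+1})>0$.
   Context: All graphs are finite and simple. A homomorphism $\phi:G\to\Gamma$ is a map $V(G)\to V(\Gamma)$ sending edges to edges. A graph is $H$-free if it has no subgraph isomorphic to $H$; $C_k$ denotes the cycle of length $k$. For a graph $G$, $|G|$ is its number of vertices and $\delta(G)$ its minimum degree. The homomorphism threshold of a graph $H$ is $\delta_{\hom}(H)=\inf\{\alpha:$ there exists a finite $H$-free graph $\Gamma=\Gamma(H,\alpha)$ such that every $H$-free graph $G$ with $\delta(G)\geq\alpha|G|$ has a homomorphism to $\Gamma\}$. *)

(* Defs.v *)
From mathcomp Require Import all_boot all_order all_algebra.
From mathcomp Require Import boolp classical_sets reals.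

Set Implicit Arguments.
Unset Strict Implicit.
Unset Printing Implicit Defensive.

Import Order.TTheory GRing.Theory Num.Theory.

Local Open Scope ring_scope.

Record sgraph : Type := SGraph {
  vertex :> finType;
  edge : rel vertex;
  edge_sym : symmetric edge;
  edge_irrefl : irreflexive edge
}.

Definition is_hom (G Gamma : sgraph) (phi : G -> Gamma) : Prop :=
  forall x y : G, edge x y -> edge (phi x) (phi y).

Definition has_hom (G Gamma : sgraph) : Prop :=
  exists phi : G -> Gamma, is_hom phi.

Definition isomorphic (G H : sgraph) : Prop :=
  exists2 f : G -> H,
    bijective f & forall x y : G, edge (f x) (f y) = edge x y.

(* Subgraphs are not required to be induced. *)
Record subgraph (G : sgraph) : Type := Subgraph {
  sub_verts : {set G};
  sub_edge : rel G;
  sub_edge_sym : symmetric sub_edge;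
  sub_edgeP : forall x y : G,
    sub_edge x y -> [/\ x \in sub_verts, y \in sub_verts & edge x y]
}.

Definition subgraph_rel (G : sgraph) (F : subgraph G) :
    rel {x : G | x \in sub_verts F} :=
  fun x y => sub_edge F (val x) (val y).

Lemma subgraph_rel_sym (G : sgraph) (F : subgraph G) :
  symmetric (@subgraph_rel G F).
Proof. by move=> x y; apply: sub_edge_sym. Qed.

Lemma subgraph_rel_irrefl (G : sgraph) (F : subgraph G) :
  irreflexive (@subgraph_rel G F).
Proof. by move=> x; apply/negP => /sub_edgeP[_ _]; rewrite edge_irrefl. Qed.

Definition graph_of_subgraph (G : sgraph) (F : subgraph G) : sgraph :=
  SGraph (@subgraph_rel_sym G F) (@subgraph_rel_irrefl G F).

Definition is_free (H G : sgraph) : Prop :=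
  forall F : subgraph G, ~ isomorphic H (graph_of_subgraph F).

Definition degree (G : sgraph) (x : G) : nat := #|[set y : G | edge x y]|.

(* Every degree is less than #|G|, so the default value #|G| of the iterated
   minimum is only reached by the graph with no vertices, where it is 0. *)
Definition min_degree (G : sgraph) : nat :=
  (\big[minn/#|G|]_(x : G) degree x)%N.

Definition cycle_rel (k : nat) : rel 'I_k :=
  fun i j => (i != j) && ((j == ordS i) || (i == ordS j)).

Lemma cycle_rel_sym (k : nat) : symmetric (@cycle_rel k).
Proof. by move=> i j; rewrite /cycle_rel eq_sym orbC. Qed.

Lemma cycle_rel_irrefl (k : nat) : irreflexive (@cycle_rel k).
Proof. by move=> i; rewrite /cycle_rel eqxx. Qed.

(* The cycle on k vertices when 3 <= k; for smaller k it is a path. *)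
Definition cycle_graph (k : nat) : sgraph :=
  SGraph (@cycle_rel_sym k) (@cycle_rel_irrefl k).

(* alpha ranges over all reals.  When H has a vertex, the set contains every
   alpha >= 1; were it unbounded below, inf would be 0 by the library's
   convention, so that 0 < hom_threshold R H is never true by default. *)
Definition hom_threshold (R : realType) (H : sgraph) : R :=
  inf [set alpha : R | exists Gamma : sgraph,
    is_free H Gamma /\
    forall G : sgraph, is_free H G ->
      alpha * #|G|%:R <= (min_degree G)%:R -> has_hom G Gamma]%classic.

(* Main.v *)
Require Import Defs.
From mathcomp Require Import all_boot all_order all_algebra.
From mathcomp Require Import boolp classical_sets reals.
From mathcomp Require Import zify.

(* Let Z be a fixed graph whose chromatic number is large in terms of r and
   which has no odd closed walk of length at most 2r+1 (an iterated line
   digraph of a transitive tournament).  Take a large set X of base points and,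
   for every map e from Z to X, a copy of Z in which each vertex z is joined to
   e z by a path of length r.  Vertices in the same position (z, j) of different
   copies may be given a common linear-sized neighbourhood without creating an
   odd closed walk of length 2r+1, and there is only a bounded number of
   positions, so the minimum degree is linear.

   A homomorphism to a bounded graph Gamma is constant, say equal to v, on the
   image of some injective e, so that it maps the corresponding copy of Z into
   the ball of radius r around v.  When Gamma is C_(2r+1)-free, this ball has a
   proper colouring whose number of colours depends only on r, by the argument
   of Erdos, Faudree, Rousseau and Schelp on the neighbourhoods of a vertex;
   hence so has Z, a contradiction. *)

Set Implicit Arguments.
Unset Strict Implicit.
Unset Printing Implicit Defensive.

Import Order.TTheory GRing.Theory Num.Theory.

Local Open Scope nat_scope.

(** * Cycles as injective homomorphisms *)

Lemma free_no_hom (H G : sgraph) :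
  (forall f : H -> G, ~ is_hom f) -> is_free H G.
Proof.
move=> noH F [f _ fE]; apply: (noH (fun x => val (f x))) => x y.
by rewrite -fE => /sub_edgeP[].
Qed.

Lemma injective_hom_not_free (H G : sgraph) (f : H -> G) :
  is_hom f -> injective f -> ~ is_free H G.
Proof.
move=> homf injf freeG.
pose V := [set x in codom f].
pose E : rel G :=
  fun x y => [exists i, exists j, [&& edge i j, x == f i & y == f j]].
have E_sym : symmetric E.
  suff sub x y : E x y -> E y x by move=> x y; apply/idP/idP; apply: sub.
  case/existsP=> i /existsP[j /and3P[ij xi yj]].
  by apply/existsP; exists j; apply/existsP; exists i; rewrite edge_sym ij xi yj.
have EP x y : E x y -> [/\ x \in V, y \in V & edge x y].
  case/existsP=> i /existsP[j /and3P[ij /eqP-> /eqP->]].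
  by rewrite !inE !codom_f; split=> //; apply: homf.
have fV i : f i \in V by rewrite inE codom_f.
apply: (freeG (Subgraph E_sym EP)).
exists (fun i => Sub (f i) (fV i) : graph_of_subgraph (Subgraph E_sym EP)).
  apply: inj_card_bij => [i j /(congr1 val) /injf //|].
  rewrite card_sig -(card_codom injf); apply/subset_leq_card/fintype.subsetP => x.
  by rewrite !inE.
move=> i j; rewrite /edge /= /subgraph_rel /=.
apply/existsP/idP => [[i' /existsP[j' /and3P[ij /eqP/injf-> /eqP/injf->]]] //|ij].
by exists i; apply/existsP; exists j; rewrite !eqxx !andbT.
Qed.

Lemma uniq_cycle_not_free (G : sgraph) (x0 : G) (p : seq G) :
  uniq (x0 :: p) -> cycle (@edge G) (x0 :: p) ->
  ~ is_free (cycle_graph (size p).+1) G.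
Proof.
set c := x0 :: p => Uc Cc.
apply: (@injective_hom_not_free (cycle_graph (size c)) G
          (fun i => nth x0 c (val i))); last first.
  move=> i j /eqP.
  by rewrite (nth_uniq x0 (ltn_ord i) (ltn_ord j) Uc) => /eqP/val_inj.
suff nextE (i : 'I_(size c)) : edge (nth x0 c i) (nth x0 c (ordS i)).
  move=> i j; rewrite {1}/edge /= /cycle_rel => /andP[_].
  by case/orP=> /eqP->; [|rewrite edge_sym]; apply: nextE.
have := next_cycle Cc (mem_nth x0 (ltn_ord i)).
rewrite next_nth mem_nth // index_uniq //=.
have [lt_i|] := ltnP i.+1 (size c); first by rewrite modn_small.
rewrite leq_eqVlt ltnNge ltn_ord orbF => /eqP[eq_i].
have -> : i.+1 %% (size p).+1 = 0 by rewrite -eq_i modnn.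
by rewrite [nth x0 p i]nth_default ?eq_i.
Qed.

(** * Colouring a ball of a C_(2r+1)-free graph *)

Section Ball.
Variables (G : sgraph) (v : G) (r : nat).

Fixpoint walk_ends (d : nat) : {set G} :=
  if d is d'.+1 then [set y | [exists x in walk_ends d', edge x y]]
  else [set v].

(* The distance to [v]; equal to [r.+1] when it exceeds [r]. *)
Definition depth (y : G) : nat :=
  find (fun d => y \in walk_ends d) (iota 0 r.+1).

Definition parent (y : G) : G :=
  odflt v [pick x | edge x y & (depth x).+1 == depth y].

Lemma depth_le d y : d <= r -> y \in walk_ends d -> depth y <= d.
Proof.
move=> le_dr yd; rewrite leqNgt; apply/negP => lt_d.
by have := before_find 0 lt_d; rewrite nth_iota // add0n yd.
Qed.

Lemma mem_depth y : depth y <= r -> y \in walk_ends (depth y).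
Proof.
move=> le_r; have: has (fun d => y \in walk_ends d) (iota 0 r.+1).
  by rewrite has_find size_iota.
by move/(nth_find 0); rewrite nth_iota.
Qed.

Lemma parentP y : 0 < depth y <= r ->
  edge (parent y) y /\ (depth (parent y)).+1 = depth y.
Proof.
case/andP=> y_gt0 y_le; rewrite /parent; case: pickP => [x /andP[xy /eqP]|no_x] //=.
have := mem_depth y_le; case def_d: (depth y) y_gt0 => [//|d] _ /=.
rewrite inE => /existsP[x /andP[xd xy]]; have /andP[] := no_x x.
split=> //; rewrite def_d eqSS eqn_leq depth_le //=; last by lia.
rewrite leqNgt; apply/negP => lt_d.
have: depth y <= (depth x).+1.
  apply: depth_le; first by lia.
  by rewrite inE; apply/existsP; exists x; rewrite mem_depth //; lia.
by lia.
Qed.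

Lemma depth_iter_parent i y :
  i <= depth y <= r -> depth (iter i parent y) = depth y - i.
Proof.
elim: i => [|i IHi] /andP[lt_i le_r]; first by rewrite subn0.
by have := @parentP (iter i parent y); rewrite IHi /=; lia.
Qed.

Lemma iter_depth_parent y : depth y <= r -> iter (depth y) parent y = v.
Proof.
move=> le_r; have := @depth_iter_parent (depth y) y; rewrite leqnn subnn => /(_ le_r) d0.
by have := @mem_depth (iter (depth y) parent y); rewrite d0 inE => /(_ isT)/eqP.
Qed.

Lemma parent_path m y : m <= depth y <= r ->
  path (@edge G) y (traject parent (parent y) m).
Proof.
elim: m y => [//|m IHm] y le_m; have [|xy dxy] := @parentP y; first by lia.
by rewrite trajectS /= edge_sym xy IHm //; lia.
Qed.

(* The tree paths of [y] and [y'] to [v] meet after exactly [i.+1] steps; the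
   branch numbers increase strictly, so a path in this relation never returns
   to a branch. *)
Definition branch_lt (i : nat) : rel G := fun y y' =>
  [&& depth y == depth y',
      iter i.+1 parent y == iter i.+1 parent y' &
      enum_rank (iter i parent y) < enum_rank (iter i parent y')].

Definition branch_edge (i : nat) : rel G := fun y y' =>
  [&& i < depth y <= r, edge y y' & branch_lt i y y'].

Lemma branch_lt_trans i : transitive (branch_lt i).
Proof.
move=> y x z /and3P[/eqP xy1 /eqP xy2 xy3] /and3P[/eqP yz1 /eqP yz2 yz3].
by rewrite /branch_lt xy1 yz1 xy2 yz2 !eqxx (ltn_trans xy3).
Qed.

Lemma branch_lt_irrefl i : irreflexive (branch_lt i).
Proof. by move=> y; rewrite /branch_lt ltnn !andbF. Qed.

Hypothesis freeG : is_free (cycle_graph (2 * r + 1)) G.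

(* Otherwise the tree paths from both ends of the path to their meeting point
   close it up to a (2r+1)-cycle. *)
Lemma branch_path_short i y s :
  i < depth y <= r -> path (branch_edge i) y s -> size s != 2 * r - 2 * i - 1.
Proof.
move=> lt_i ys; apply/eqP => size_s.
have lt_ys : path (branch_lt i) y s by apply: sub_path ys => x x' /and3P[].
have edge_ys : path (@edge G) y s by apply: sub_path ys => x x' /and3P[].
have {ys} /allP all_s := order_path_min (@branch_lt_trans i) lt_ys.
have Us : uniq (y :: s).
  by apply: (sorted_uniq (@branch_lt_trans i) (@branch_lt_irrefl i)).
set x := last y s; have xs : x \in s.
  by rewrite /x; case: (s) size_s => [|a s'] /=; [lia | rewrite mem_last].
have /and3P[/eqP dxy /eqP meet lt_rank] := all_s x xs.
pose up m z := traject parent (parent z) m.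
have upP m z t : m <= depth z <= r -> t \in up m z ->
    exists2 a, 0 < a <= m & t = iter a parent z /\ depth t = depth z - a.
  move=> le_m /trajectP[a lt_a ->]; exists a.+1 => //.
  by rewrite -iterSr depth_iter_parent //; lia.
have Uup m z : m <= depth z <= r -> uniq (up m z).
  move=> le_m; apply: (@map_uniq _ _ depth).
  have -> : [seq depth t | t <- up m z] = [seq depth z - a | a <- iota 1 m].
    apply: (@eq_from_nth _ 0) => [|a]; rewrite !size_map size_traject ?size_iota // => lt_a.
    rewrite (nth_map (parent z)) ?size_traject // (nth_map 0) ?size_iota //.
    by rewrite nth_traject // nth_iota // -iterSr depth_iter_parent //; lia.
  rewrite map_inj_in_uniq ?iota_uniq // => a b.
  by rewrite !mem_iota; lia.
(* The cycle runs along [s] to [x], up [i.+1] steps to the meeting point and back down to [y]; its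
   length is 1 + (2r-2i-1) + (i+1) + i = 2r+1. *)
pose p := s ++ up i.+1 x ++ rev (up i y).
have size_p : (size p).+1 = 2 * r + 1.
  by rewrite !size_cat size_rev !size_traject size_s; lia.
have Cp : cycle (@edge G) (y :: p).
  rewrite /= rcons_cat cat_path edge_ys -/x rcons_cat cat_path.
  rewrite parent_path -?dxy //.
  rewrite !andTb.
  have -> : rcons (rev (up i y)) y = rev (belast y (up i.+1 y)).
    rewrite -rev_cons; congr rev.
    by rewrite /up trajectSr belast_rcons.
  have -> : last x (traject parent (parent x) i.+1) = last y (up i.+1 y).
    by rewrite !last_traject meet.
  rewrite rev_path; apply: sub_path (parent_path lt_i) => a b.
  by rewrite edge_sym.
have Up : uniq (y :: p).
  rewrite -cat_cons !cat_uniq Us rev_uniq !Uup -?dxy //; last by lia.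
  rewrite !andbT !andTb; apply/andP; split.
    have up_lt m z t : 0 < depth z -> m <= depth z <= r -> t \in up m z ->
        depth t < depth z.
      by move=> z_gt0 le_m /(upP _ _ _ le_m)[a a_gt [_ ->]]; lia.
    apply/hasPn => t; rewrite mem_cat mem_rev => t_up.
    have {t_up}: depth t < depth y.
      by case/orP: t_up => /up_lt; [rewrite -dxy|]; apply; lia.
    apply: contraL; rewrite inE => /predU1P[->|/all_s/and3P[/eqP<- _ _]];
      by rewrite ltnn.
  (* A common vertex would lie [a <= i] steps above both ends, making their [i]-th ancestors equal,
     against [lt_rank]. *)
  apply/hasPn => t; rewrite mem_rev => ty; apply/negP => tx.
  have [|a a_gt [ta dta]] := upP _ _ _ _ ty; first by lia.
  have [|b b_gt [tb dtb]] := upP _ _ _ _ tx; first by rewrite -dxy.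
  have eq_ab : a = b by lia.
  move: lt_rank; rewrite -(subnK (_ : a <= i)) ?iterD; last by lia.
  by rewrite -ta eq_ab -tb ltnn.
by have := uniq_cycle_not_free Up Cp; rewrite size_p.
Qed.

Fixpoint has_chain (i l : nat) (y : G) : bool :=
  if l is l'.+1 then [exists y', branch_edge i y y' && has_chain i l' y']
  else true.

Lemma has_chainP i l y :
  has_chain i l y -> exists2 s, size s = l & path (branch_edge i) y s.
Proof.
elim: l y => [|l IHl] y; first by exists [::].
case/existsP=> z /andP[yz /IHl[s <- zs]].
by exists (z :: s); rewrite //= yz.
Qed.

(** The Gallai-Roy colouring of the acyclic digraph [branch_edge i], by longest directed paths. *)
Definition height (i : nat) (y : G) : nat :=
  \max_(l < (2 * r).+1 | has_chain i l y) l.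

Lemma height_lt i y y' : branch_edge i y y' -> height i y' < height i y.
Proof.
move=> yy'.
have [l y'l ->] : {l : 'I_(2 * r).+1 | has_chain i l y' & height i y' = l}.
  apply: (@eq_bigmax_cond _ [pred l : 'I__ | has_chain i l y'] (fun l => val l)).
  by apply/card_gt0P; exists ord0.
have yl : has_chain i l.+1 y by apply/existsP; exists y'; rewrite yy'.
(* The cap 2r in [height] is harmless: a longer chain would have an initial segment of the forbidden
   length 2r-2i-1. *)
have lt_l : l.+1 < (2 * r).+1.
  rewrite ltnS leqNgt; apply/negP => ge_l.
  have [s size_s ys] := has_chainP yl; have /and3P[lt_i _ _] := yy'.
  have /(branch_path_short lt_i) : path (branch_edge i) y (take (2 * r - 2 * i - 1) s).
    by move: ys; rewrite -{1}(cat_take_drop (2 * r - 2 * i - 1) s) cat_path => /andP[].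
  by rewrite size_take size_s; case: ltnP; lia.
exact: (@leq_bigmax_cond _ (fun l : 'I_(2 * r).+1 => has_chain i l y)
         (fun l => val l) (Ordinal lt_l)).
Qed.

Definition ball_color (y : G) : 'I_r.+1 * {ffun 'I_r -> 'I_(2 * r).+1} :=
  (inord (depth y), [ffun i : 'I_r => inord (height i y)]).

Lemma height_le i y : height i y <= 2 * r.
Proof. by apply/bigmax_leqP => l _; rewrite -ltnS. Qed.

(** The tree paths of adjacent vertices of equal depth first meet after some [i.+1] steps, so the
    edge is a [branch_edge i] in one direction and [height i] separates its ends. *)
Lemma ball_color_proper y y' :
  y \in walk_ends r -> y' \in walk_ends r -> edge y y' ->
  ball_color y <> ball_color y'.
Proof.
move=> /(depth_le (leqnn r)) y_r /(depth_le (leqnn r)) y'_r yy' [].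
move/(congr1 val); rewrite /= !inordK // => dyy' hyy'.
have meets : exists i, iter i parent y == iter i parent y'.
  by exists (depth y); rewrite iter_depth_parent // dyy' iter_depth_parent.
case: (ex_minnP meets) => [[|i] /eqP meet min_i].
  by move: yy'; rewrite -[y]/(iter 0 parent y) meet edge_irrefl.
have lt_i : i < depth y.
  by apply: min_i; rewrite iter_depth_parent // dyy' iter_depth_parent.
have lt_ir : i < r by lia.
move/ffunP/(_ (Ordinal lt_ir)): hyy'; rewrite !ffunE => /(congr1 val).
rewrite /= !inordK ?ltnS ?height_le // => hyy'.
have : enum_rank (iter i parent y) != enum_rank (iter i parent y').
  by rewrite (inj_eq enum_rank_inj); apply/eqP => /eqP/min_i; rewrite ltnn.
rewrite -(inj_eq val_inj) /= neq_ltn => /orP[lt_rank|lt_rank].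
  suff /height_lt : branch_edge i y y' by lia.
  by rewrite /branch_edge /branch_lt lt_i y_r yy' dyy' meet !eqxx.
suff /height_lt : branch_edge i y' y by lia.
by rewrite /branch_edge /branch_lt -dyy' lt_i y_r edge_sym yy' meet !eqxx.
Qed.

End Ball.

(** * Iterated line digraphs *)

(* [lab z] lists a vertex [z] of the shift digraph as an increasing tuple of
   length [k.+1].  In the step from [Z] to its line digraph, a colouring [f] of
   the arcs yields the colouring of [Z] by sets of colours of outgoing arcs. *)
Lemma exists_shift_digraph (k : nat) (C : finType) :
  exists (Z : finType) (lab : Z -> nat -> nat) (arc : rel Z),
  [/\ forall z p q, p < q <= k -> lab z p < lab z q,
      forall z z', arc z z' -> lab z 0 < lab z' 0,
      forall z z', arc z z' -> forall q, q < k -> lab z q.+1 = lab z' q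
    & forall f : Z -> C, exists z z', arc z z' /\ f z = f z'].
Proof.
elim: k C => [|k IHk] C.
  exists 'I_#|C|.+1, (fun z _ => val z), (fun z z' => val z < val z').
  split=> // [z p q|f]; first by case: q => [|q] /andP[].
  have /injectivePn[z [z' neq_z eq_f]] : ~~ injectiveb f.
    by apply/injectiveP => /leq_card; rewrite card_ord ltnn.
  move: neq_z; rewrite -val_eqE neq_ltn => /orP[] lt_z.
    by exists z, z'.
  by exists z', z.
have [Z [lab [arc [lab_lt arc_lt arc_lab arc_col]]]] := IHk {set C}.
exists {p : Z * Z | arc p.1 p.2}.
exists (fun p q => if q is q'.+1 then lab (val p).2 q' else lab (val p).1 0).
exists (fun p p' => (val p).2 == (val p').1).
split=> [[[z z'] /= zz'] [|p] [|q] //= | | |f].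
- move=> le_qk; apply: leq_trans (arc_lt _ _ zz') _.
  by case: q le_qk => // q le_qk; apply/ltnW/lab_lt.
- exact: lab_lt.
- by move=> [[x y] /= xy] [[y' z] /= yz] /eqP <-; apply: arc_lt.
- move=> [[x y] /= xy] [[y' z] /= yz] /eqP ey q lt_qk; rewrite ey.
  by case: q lt_qk => // q lt_qk; apply: arc_lab.
have [z [z' [zz' eq_g]]] :=
  arc_col (fun z => [set f p | p in [pred p | (val p).1 == z]]).
(* The colour of the arc from [z] to [z'] also occurs on an arc [p'] leaving [z'], and these two
   arcs are consecutive. *)
have /imsetP[p' /eqP p'1 eq_f] :
    f (Sub (z, z') zz') \in [set f p | p in [pred p | (val p).1 == z']].
  by rewrite -eq_g imset_f // inE.
by exists (Sub (z, z') zz'), p'; rewrite p'1 eqxx.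
Qed.

(** * The dense graphs *)

Section Gadget.
Variables (r N : nat) (Z : finType) (arc : rel Z) (lab : Z -> nat -> nat).

(* In [core], [inl x] is a base point and [inr (e, (z, j))] is the vertex at
   distance [j.+1] from the base point [e z] on the path to the vertex [z] of the
   copy [e]; the copy of [Z] itself is at [j.+1 = r].  Each class [t] of core
   vertices is joined completely to the vertices [(t, false, _)], and these to
   the vertices [(t, true, _)].  The condition [e z != e z'] on the edges of a
   copy makes it unnecessary to require [e] to be injective. *)
Definition core_class : Type := option (Z * 'I_r).
Definition core : Type := ('I_N + {ffun Z -> 'I_N} * (Z * 'I_r))%type.
Definition gadget : Type := (core + core_class * bool * core)%type.

Definition class_of (u : core) : core_class :=
  if u is inr (_, t) then Some t else None.

Definition gadget_arc : rel gadget := fun u w =>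
  match u, w with
  | inl (inl x), inl (inr (e, (z, j))) => (e z == x) && (j == 0 :> nat)
  | inl (inr (e, (z, j))), inl (inr (e', (z', j'))) =>
      (e == e') && (((z == z') && (j' == j.+1 :> nat)) ||
                    [&& arc z z', e z != e z', j.+1 == r & j'.+1 == r])
  | inl u, inr (t, false, _) => class_of u == t
  | inr (t, false, _), inr (t', true, _) => t == t'
  | _, _ => false
  end.

Definition gadget_edge : rel gadget :=
  fun u w => gadget_arc u w || gadget_arc w u.

Lemma gadget_edge_sym : symmetric gadget_edge.
Proof. by move=> u w; rewrite /gadget_edge orbC. Qed.

Lemma gadget_edge_irrefl : irreflexive gadget_edge.
Proof.
move=> u; rewrite /gadget_edge orbb; case: u => [[x|[e [z j]]]|[[t []] u]] //=.
by rewrite !eqxx andbF orbF; lia.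
Qed.

Definition gadget_graph : sgraph := SGraph gadget_edge_sym gadget_edge_irrefl.

Definition class_level (t : core_class) : nat :=
  if t is Some (_, j) then j.+1 else 0.

(** A potential that changes by exactly one along every edge, except along the arcs of a copy of
    [Z], which have level [r] at both ends. *)
Definition level (u : gadget) : nat :=
  match u with
  | inl u => class_level (class_of u)
  | inr (t, b, _) => class_level t + ~~ b
  end.

Definition is_base (u : gadget) : bool :=
  if u is inl (inl _) then true else false.

(* The other vertices get [id], which is increasing like the labels of [Z]. *)
Definition foot_label (u : gadget) : nat -> nat :=
  match u with
  | inl (inr (_, (z, _))) | inr (Some (z, _), _, _) => lab z
  | _ => id
  end.

Definition same_foot (u w : gadget) : Prop :=
  (level u = (level w).+1 \/ level w = (level u).+1) /\
  (~~ is_base u -> ~~ is_base w -> foot_label u = foot_label w).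

Definition top_arc (u w : gadget) : Prop :=
  exists e z z' j j', [/\ u = inl (inr (e, (z, j))), w = inl (inr (e, (z', j'))),
    level u = r /\ level w = r, arc z z' & e z != e z'].

Lemma gadget_arcP (u w : gadget) :
  gadget_arc u w -> same_foot u w \/ top_arc u w.
Proof.
case: u => [[x|[e [z j]]]|[[t []] u]];
  case: w => [[x'|[e' [z' j']]]|[[t' []] u']] //=.
- by case/andP=> _ /eqP j'0; left; split; [right; rewrite /= j'0|].
- by move/eqP<-; left; split; [right|].
- case/andP=> /eqP<- /orP[/andP[/eqP<- /eqP j'S]|/and4P[zz' ezz' /eqP jr /eqP j'r]].
    by left; split; [right; rewrite /= j'S|].
  by right; exists e, z, z', j, j'; split=> //=; rewrite jr j'r.
- by move/eqP<-; left; split; [right; rewrite /= addn1|].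
- by move/eqP<-; left; split=> //; left; rewrite /= addn1 addn0.
Qed.

Lemma gadget_edgeP (u w : gadget) : gadget_edge u w ->
  same_foot u w \/ (top_arc u w \/ top_arc w u).
Proof.
case/orP=> /gadget_arcP[|]; rewrite /same_foot; first by left.
- by right; left.
- case=> lev_uw foot_uw; left; split=> [|u0 w0]; first by case: lev_uw; [right|left].
  by rewrite foot_uw.
- by right; right.
Qed.

Lemma level_lip (u w : gadget) : gadget_edge u w -> level u <= (level w).+1.
Proof.
case/gadget_edgeP=> [[[->|->] _]|[]] //.
- by rewrite leqW.
- by move=> [e [z [z' [j [j' [_ _ [-> ->] _ _]]]]]].
- by move=> [e [z [z' [j [j' [_ _ [-> ->] _ _]]]]]].
Qed.

Lemma walk_level (w : nat -> gadget) m :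
  is_base (w 0) -> (forall i, i < m -> gadget_edge (w i) (w i.+1)) ->
  level (w m) <= m.
Proof.
move=> w0; elim: m => [|m IHm] w_edge; first by case: (w 0) w0 => [[]|].
have := w_edge m (leqnn _); rewrite gadget_edge_sym => /level_lip.
by move/leq_trans; apply; apply: IHm => i lt_i; apply: w_edge; lia.
Qed.

(** Reaching level [m] in [m] steps forces a climb at every step, and the only neighbour one level
    below a path vertex is the preceding one on its path. *)
Lemma straight_walk (w : nat -> gadget) x m e z j :
  w 0 = inl (inl x) -> (forall i, i < m -> gadget_edge (w i) (w i.+1)) ->
  w m = inl (inr (e, (z, j))) -> m = j.+1 -> e z = x.
Proof.
move=> w0; elim: m j => [|m IHm] j w_edge wm; first by [].
move=> [def_m]; have := w_edge m (leqnn _).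
have w_edge' i : i < m -> gadget_edge (w i) (w i.+1) by move=> lt_i; apply: w_edge; lia.
have := @walk_level w m _ w_edge'; rewrite w0 => /(_ isT).
have {}IHm := IHm _ w_edge'.
rewrite wm; case def_w: (w m) => [[x'|[e' [z' j']]]|[[t' []] u']];
  rewrite /gadget_edge //= ?orbF ?orFb.
- move=> _ /andP[/eqP-> /eqP j0]; move: def_w.
  by rewrite def_m j0 w0 => -[].
- move=> le_j' /orP[] /andP[/eqP ee' /orP[/andP[/eqP zz' /eqP jj']|/and4P[_ _ ? ?]]];
    try by lia.
  by subst e' z'; apply: (IHm _ def_w); lia.
- by move=> le_m /eqP def_t; move: le_m; rewrite -def_t /=; lia.
Qed.

Lemma card_gadget : #|gadget_graph| = #|{: core}| * (2 * #|{: core_class}|).+1.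
Proof.
have distr a b : a + b * 2 * a = a * (2 * b).+1 by lia.
by rewrite card_sum !card_prod card_bool; apply: distr.
Qed.

Lemma gadget_min_degree : #|{: core}| <= min_degree gadget_graph.
Proof.
have deg_ge (f : core -> gadget) (u : gadget) :
    injective f -> (forall k, gadget_edge u (f k)) ->
    #|{: core}| <= degree (u : gadget_graph).
  move=> injf uf; rewrite -(card_codom injf); apply/subset_leq_card/fintype.subsetP.
  by move=> _ /codomP[k ->]; rewrite inE; apply: uf.
rewrite /min_degree; elim/big_ind: _ => [|m n|u _].
- by rewrite card_gadget leq_pmulr.
- by rewrite leq_min => -> ->.
case: u => [u|[[t []] k0]].
- by apply: (deg_ge (fun k => inr (class_of u, false, k))) => [k k' []|k] //;
    rewrite /gadget_edge; case: u => [x|[e [z j]]]; rewrite /= ?eqxx.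
- by apply: (deg_ge (fun k => inr (t, false, k))) => [k k' []|k] //;
    rewrite /gadget_edge /= eqxx ?orbT.
- by apply: (deg_ge (fun k => inr (t, true, k))) => [k k' []|k] //;
    rewrite /gadget_edge /= eqxx ?orbT.
Qed.

Hypothesis lab_lt : forall z p q, p < q <= 4 * r + 2 -> lab z p < lab z q.
Hypothesis arc_lab :
  forall z z', arc z z' -> forall q, q < 4 * r + 2 -> lab z q.+1 = lab z' q.

Lemma foot_label_lt u p q :
  p < q <= 4 * r + 2 -> foot_label u p < foot_label u q.
Proof.
case: u => [[x|[e [z j]]]|[[[[z j]|] b] u]] /=; try exact: lab_lt.
- by case/andP.
- by case/andP.
Qed.

(* An entry of the label of the foot can be followed along the walk: it moves
   by one position exactly at the arcs between two copies of [Z]-vertices, so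
   its total displacement has the parity of the number of such arcs. *)
Lemma track_label (w : nat -> gadget) m :
  m <= 2 * r + 1 -> (forall i, i < m -> gadget_edge (w i) (w i.+1)) ->
  (forall i, i <= m -> ~~ is_base (w i)) ->
  exists q, [/\ q <= 2 * r + 1 + m, 2 * r + 1 <= q + m,
    odd (q + level (w m) + m) = odd (2 * r + 1 + level (w 0)) &
    foot_label (w m) q = foot_label (w 0) (2 * r + 1)].
Proof.
elim: m => [|m IHm] le_m w_edge w_base.
  (* The start is the middle of the positions 0, ..., 4r+2, leaving room for 2r+1 shifts either
     way. *)
  by exists (2 * r + 1); rewrite !addn0 leqnn.
have [| | |q [q_le q_ge q_odd q_lab]] := IHm; first by lia.
- by move=> i lt_i; apply: w_edge; lia.
- by move=> i le_i; apply: w_base; lia.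
case/gadget_edgeP: (w_edge m (leqnn _)) => [[lev eq_foot]|[]].
- exists q; rewrite -eq_foot ?w_base //; split=> //; [lia | lia |].
  by rewrite -q_odd; case: lev => ->; lia.
- case=> e [z [z' [j [j' [def_u def_w [ru rw] zz' _]]]]].
  exists q.-1; split; [lia | lia | by rewrite -q_odd ru rw; lia |].
  rewrite -q_lab def_u def_w /= -(arc_lab zz') ?prednK //; lia.
- case=> e [z [z' [j [j' [def_w def_u [rw ru] zz' _]]]]].
  exists q.+1; split; [lia | lia | by rewrite -q_odd ru rw; lia |].
  by rewrite -q_lab def_u def_w /= (arc_lab zz') //; lia.
Qed.

(** On return the displacement has the parity of the odd length, so it is non-zero and a strictly
    increasing label would take one value twice. *)
Lemma no_closed_walk_off_base (w : nat -> gadget) :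
  (forall i, gadget_edge (w i) (w i.+1)) -> w (2 * r + 1) = w 0 ->
  (forall i, ~~ is_base (w i)) -> False.
Proof.
move=> w_edge closed w_base.
have [|||q [q_le q_ge q_odd q_lab]] := @track_label w (2 * r + 1) => //.
move: q_lab q_odd; rewrite closed => q_lab q_odd.
have: q != 2 * r + 1 by apply/eqP => def_q; move: q_odd; rewrite def_q; lia.
rewrite neq_ltn => /orP[] lt_q.
  by have := @foot_label_lt (w 0) q (2 * r + 1); rewrite q_lab; lia.
by have := @foot_label_lt (w 0) (2 * r + 1) q; rewrite q_lab; lia.
Qed.

(* Such a walk uses a top arc, and has just enough steps to climb to it and to
   come back down. *)
Lemma no_closed_walk_at_base (w : nat -> gadget) :
  (forall i, gadget_edge (w i) (w i.+1)) -> w (2 * r + 1) = w 0 ->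
  is_base (w 0) -> False.
Proof.
move=> w_edge closed w0.
have [x def_x] : exists x, w 0 = inl (inl x).
  by case: (w 0) w0 => [[x|]|] //; exists x.
pose w' i := w (2 * r + 1 - i).
have w'_edge i : i < 2 * r + 1 -> gadget_edge (w' i) (w' i.+1).
  move=> lt_i; rewrite /w' gadget_edge_sym.
  by have -> : 2 * r + 1 - i = (2 * r + 1 - i.+1).+1 by lia.
have w'0 : w' 0 = inl (inl x) by rewrite /w' subn0 closed.
(* A top arc at step [i] gives [r <= i] and [r <= 2 * r - i], so [w] and its reversal [w'] both
   climb straight from [x] to it, whence [e z = x = e z']. *)
have no_top i e z z' j j' : i < 2 * r + 1 ->
    w i = inl (inr (e, (z, j))) -> w i.+1 = inl (inr (e, (z', j'))) ->
    level (w i) = r -> level (w i.+1) = r -> e z != e z' -> False.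
  move=> lt_i def_i def_iS lev_i lev_iS.
  have le_i : level (w i) <= i by apply: walk_level.
  have le_iS : level (w' (2 * r - i)) <= 2 * r - i.
    by apply: walk_level => [|a lt_a]; [rewrite w'0|apply: w'_edge; lia].
  have w'_iS : w' (2 * r - i) = w i.+1 by congr w; lia.
  rewrite w'_iS in le_iS; rewrite lev_i in le_i; rewrite lev_iS in le_iS.
  have -> : e z = x.
    by apply: (straight_walk def_x _ def_i) => //; move: lev_i; rewrite def_i /=; lia.
  have -> : e z' = x; last by rewrite eqxx.
  apply: (straight_walk w'0 _ (etrans w'_iS def_iS)) => [a lt_a|].
    by apply: w'_edge; lia.
  by move: lev_iS; rewrite def_iS /=; lia.
(* Without top arcs the level changes parity at each step, so a walk of odd length cannot close. *)
have lev_odd m : m <= 2 * r + 1 -> odd (level (w m)) = odd m.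
  elim: m => [|m IHm] le_m; first by rewrite def_x.
  have {}IHm := IHm (ltnW le_m).
  case/gadget_edgeP: (w_edge m) => [[lev _]|[]].
  - by case: lev; lia.
  - case=> e [z [z' [j [j' [def_u def_w [ru rw] _ ezz']]]]].
    by case: (no_top _ _ _ _ _ _ le_m def_u def_w ru rw ezz').
  - case=> e [z [z' [j [j' [def_w def_u [rw ru] _ ezz']]]]].
    by rewrite eq_sym in ezz'; case: (no_top _ _ _ _ _ _ le_m def_u def_w ru rw ezz').
by have := lev_odd _ (leqnn _); rewrite closed def_x /=; lia.
Qed.

Lemma gadget_graph_free :
  0 < r -> is_free (cycle_graph (2 * r + 1)) gadget_graph.
Proof.
move=> r_gt0; apply: free_no_hom => f homf; set k := 2 * r + 1 in f homf *.
have k_gt1 : 1 < k by lia.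
pose c i : 'I_k := Ordinal (ltn_pmod i (ltnW k_gt1)).
pose w i : gadget := f (c i).
have w_per i : w (i + k) = w i.
  by congr (f _); apply: val_inj; rewrite /= modnDr.
have w_edge i : gadget_edge (w i) (w i.+1).
  apply: (homf (c i) (c i.+1)); rewrite /edge /= /cycle_rel -!val_eqE /=.
  have -> : (i.+1 %% k == (i %% k).+1 %% k) by rewrite -[i.+1]addn1 -modnDml addn1.
  rewrite andbT -{1}[i]addn0 -[i.+1]addn1 eqn_modDl mod0n modn_small //.
have [/existsP[i0 base_i0]|/existsPn no_base] :=
    boolP [exists i : 'I_k, is_base (f i)].
  apply: (@no_closed_walk_at_base (fun i => w (i0 + i))).
  - by move=> i; rewrite addnS.
  - by rewrite w_per addn0.
  - rewrite addn0 /w (_ : c i0 = i0) //.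
    by apply: val_inj; rewrite /= modn_small.
by apply: (no_closed_walk_off_base w_edge (w_per 0)) => i; apply: no_base.
Qed.

End Gadget.

(** * The homomorphism threshold *)

Lemma constant_on_injection (A B Z : finType) (f : A -> B) :
  #|B| * #|Z| < #|A| ->
  exists e : Z -> A, injective e /\ exists b, forall z, f (e z) = b.
Proof.
move=> lt_A; have [b ge_b|small] := pickP (fun b => #|Z| <= #|[set a | f a == b]|).
  have lt_z (z : Z) : enum_rank z < size (enum [set a | f a == b]).
    by rewrite -cardE; apply: leq_trans ge_b.
  have [a0 _] : exists a0 : A, a0 \in A by apply/card_gt0P; case: #|A| lt_A.
  exists (fun z => nth a0 (enum [set a | f a == b]) (enum_rank z)).
  split=> [z z' /eqP|].
    by rewrite nth_uniq ?enum_uniq // => /eqP/val_inj/enum_rank_inj.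
  exists b => z; have := mem_nth a0 (lt_z z).
  by rewrite mem_enum inE => /eqP.
suff : #|A| <= #|B| * #|Z| by rewrite leqNgt lt_A.
rewrite -sum1_card (partition_big f xpredT) //= -sum_nat_const leq_sum // => b _.
have := negbT (small b); rewrite -ltnNge => /ltnW; apply: leq_trans.
by rewrite -sum1_card; under [X in _ <= X]eq_bigl do rewrite inE.
Qed.

Local Open Scope ring_scope.

Theorem theorem1p1 (R : realType) (r : nat) :
  (2 <= r)%N -> 0 < hom_threshold R (cycle_graph (2 * r + 1)).
Proof.
move=> /ltnW r_gt0.
have [Z [lab [arc [lab_lt arc_lt arc_lab arc_col]]]] :=
  exists_shift_digraph (4 * r + 2) ('I_r.+1 * {ffun 'I_r -> 'I_(2 * r).+1})%type.
(* The ratio of the order of the gadget to that of its core, independent of [N]. *)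
pose K := (2 * #|{: core_class r Z}|).+1.
apply: (@lt_le_trans _ _ K%:R^-1); first by rewrite invr_gt0 ltr0n.
apply: lb_le_inf => [|alpha [Gamma [freeGamma homGamma]]].
  (* The set is non-empty: for [alpha = 1] only the empty graph meets the degree condition, so the
     empty [Gamma] serves. *)
  have void_irrefl : irreflexive (fun _ _ : void => true) by case.
  exists 1; exists (@SGraph void (fun _ _ => true) (fun _ _ => erefl) void_irrefl).
  split=> [|G _].
    by apply: free_no_hom => f; case: (f (Ordinal (ltn_addl (2 * r) (ltnSn 0)))).
  rewrite mul1r ler_nat => deg_G.
  have noG (x : G) : False.
    have: (#|G| <= degree x)%N.
      exact: leq_trans deg_G (@bigmin_le _ nat _ _ x (@degree G)).
    rewrite leqNgt /degree -[X in (_ < X)%N]cardsT proper_card //.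
    by rewrite properT; apply/eqP => /setP/(_ x); rewrite !inE edge_irrefl.
  by exists (fun x => False_rect _ (noG x)) => x; case: (noG x).
rewrite leNgt; apply/negP => lt_alpha.
pose N := (#|Gamma| * #|Z|).+1.
pose G := gadget_graph r N arc.
have [phi homphi] : has_hom G Gamma.
  apply: homGamma; first exact: (gadget_graph_free lab_lt arc_lab).
  apply: (@le_trans _ _ #|{: core r N Z}|%:R); last first.
    by rewrite ler_nat gadget_min_degree.
  rewrite card_gadget natrM mulrCA ler_piMr ?ler0n //.
  by rewrite -ler_pdivlMr ?ltr0n // mul1r ltW.
have [|e [inj_e [v ev]]] :=
  @constant_on_injection 'I_N Gamma Z (fun x => phi (inl (inl x))).
  by rewrite card_ord.
pose leg z j : G := inl (inr (finfun e, (z, j))).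
have leg_end z j : phi (leg z j) \in walk_ends v j.+1.
  case: j => j; elim: j => [|j IHj] lt_j; rewrite inE; apply/existsP.
    exists v; rewrite inE eqxx /= -(ev z); apply: homphi.
    by rewrite /edge /= /gadget_edge /= ffunE eqxx.
  exists (phi (leg z (Ordinal (ltnW lt_j)))); rewrite IHj; apply: homphi.
  by rewrite /edge /= /gadget_edge /= !eqxx.
have top_lt : (r.-1 < r)%N by rewrite prednK.
pose top z := leg z (Ordinal top_lt).
have [z [z' [zz' eq_col]]] := arc_col (fun z => ball_color v r (phi (top z))).
have top_end y : phi (top y) \in walk_ends v r.
  suff: phi (top y) \in walk_ends v r.-1.+1 by rewrite prednK.
  exact: leg_end.
apply: (ball_color_proper freeGamma (top_end z) (top_end z') _ eq_col).
apply: homphi; rewrite /edge /= /gadget_edge /= !eqxx !ffunE zz' prednK // eqxx.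
(* Injectivity of [e] yields the condition [e z != e z'] on the edges of a copy. *)
rewrite (inj_eq inj_e).
have -> : z != z' by apply: contraTneq (arc_lt _ _ zz') => ->; rewrite ltnn.
by rewrite !orbT.
Qed.
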